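(* Let $\Omega$ be an infinite set, let $\mathbf{V}$ be a variety of finitary algebras, and let $F:\mathbf{Set}\to\mathbf{V}$ be a functor such that, for every set $I$, the algebra $F(I)$ is the union of the images of the homomorphisms $F(a):F(n)\to F(I)$, where $n$ ranges over the natural numbers and $a$ ranges over all set maps $n\to I$. Then the direct power algebra $F(\aleph_0)^{\mathrm{card}(\Omega)}$ has a subalgebra isomorphic to $F(2^{\mathrm{card}(\Omega)})$.
   Context: ''Algebra'' and ''variety'' are in the sense of universal algebra; ''finitary'' means every operation has finite arity (infinitely many operations are allowed). $\mathbf{V}$ is regarded as a category with all algebra homomorphisms as morphisms. Each natural number $n$ is identified with the set $\{0,\dots,n-1\}$, and each cardinal with an (initial) ordinal, which is the set of all smaller ordinals; so $F(\aleph_0)$ and $F(2^{\mathrm{card}(\Omega)})$ denote the values of $F$ at sets of those cardinalities. *)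

(* Defs.v *)
From mathcomp Require Import all_boot.
From mathcomp Require Import boolp classical_sets cardinality.

Set Implicit Arguments.
Unset Strict Implicit.
Unset Printing Implicit Defensive.

Local Open Scope classical_set_scope.

Record signature := Signature {
  symbol : Type;
  arity : symbol -> nat }.

(* Carriers may be empty. *)
Record algebra (S : signature) := Algebra {
  carrier :> Type;
  op : forall o : symbol S, ('I_(arity o) -> carrier) -> carrier }.

Record hom (S : signature) (A B : algebra S) := Hom {
  hom_fun :> A -> B;
  homP : forall (o : symbol S) (x : 'I_(arity o) -> A),
    hom_fun (op x) = op (hom_fun \o x) }.

Inductive term (S : signature) (X : Type) : Type :=
| Var of X
| App (o : symbol S) of ('I_(arity o) -> term S X).

Fixpoint eval (S : signature) (X : Type) (A : algebra S) (v : X -> A)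
    (t : term S X) : A :=
  match t with
  | Var x => v x
  | App o ts => op (fun i => eval v (ts i))
  end.

Record variety := Variety {
  sig_of : signature;
  identities : set (term sig_of nat * term sig_of nat) }.

Definition satisfies (V : variety) (A : algebra (sig_of V)) : Prop :=
  forall e, identities e -> forall v : nat -> A, eval v e.1 = eval v e.2.

Record valgebra (V : variety) := VAlgebra {
  valg :> algebra (sig_of V);
  valgP : satisfies valg }.

(* Functors from the category of sets (types and functions) to V, a full
   subcategory of the category of algebras. *)
Record set_functor (V : variety) := SetFunctor {
  fobj :> Type -> valgebra V;
  fmap : forall I J : Type, (I -> J) -> hom (fobj I) (fobj J);
  fmap_id : forall (I : Type) (x : fobj I), fmap id x = x;
  fmap_comp : forall (I J K : Type) (g : J -> K) (f : I -> J) (x : fobj I),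
    fmap (g \o f) x = fmap g (fmap f x) }.

Arguments fmap {V} s {I J} _.

Definition power (S : signature) (A : algebra S) (K : Type) : algebra S :=
  @Algebra S (K -> A) (fun o x k => op (fun i => x i k)).

Record subalgebra (S : signature) (A : algebra S) := Subalgebra {
  subset_of : set A;
  subset_op : forall (o : symbol S) (x : 'I_(arity o) -> A),
    (forall i, subset_of (x i)) -> subset_of (op x) }.

Definition alg_of_sub (S : signature) (A : algebra S) (B : subalgebra A) :
    algebra S :=
  @Algebra S {a : A | subset_of B a}
    (fun o x => exist _ (op (fun i => sval (x i)))
                        (subset_op (fun i => svalP (x i)))).

Coercion alg_of_sub : subalgebra >-> algebra.

Definition isomorphic (S : signature) (A B : algebra S) : Prop :=
  exists f : hom A B, bijective f.

(* Main.v *)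
(** Any family of maps [phi w : (Omega -> bool) -> nat], indexed by
    [w : Omega], induces a homomorphism [F (Omega -> bool) -> F nat ^ Omega].
    It is injective as soon as every finite subset of [Omega -> bool] is mapped
    injectively by some [phi w]: two elements of [F (Omega -> bool)] come from
    finite sets, and on the union of these some [phi w] has a left inverse.
    A finite set of functions is separated by its restrictions to finitely many
    coordinates, and such a restriction takes finitely many values, so one map
    per finite sequence over [Omega] suffices; these sequences are no more
    numerous than [Omega] because [Omega] is infinite. *)
From Stdlib Require List.
Require Import Defs.
From mathcomp Require Import all_boot.
From mathcomp Require Import boolp classical_sets cardinality.

Local Open Scope classical_set_scope.

Lemma choice_on {T : Type} {U : pointedType} {A : set T} {P : T -> U -> Prop} :
  (forall x, A x -> exists y, P x y) -> exists f, forall x, A x -> P x (f x).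
Proof.
move=> AP; suff /choice[f fP] : forall x, exists y, A x -> P x y by exists f.
by move=> x; have [/AP[y Pxy]|nAx] := pselect (A x); [exists y|exists point].
Qed.

(** By Zorn's lemma there is a maximal graph [G] of a partial injection from [A] to [B]. It is total
    on [A] or onto [B], since otherwise a pair of unmatched points could be added. *)
Lemma card_le_total {T U : Type} (A : set T) (B : set U) :
  (A #<= B)%card \/ (B #<= A)%card.
Proof.
elim/Ppointed: T => T in A *; first by left; rewrite (empty_eq0 A) card_ge0.
elim/Ppointed: U => U in B *; first by right; rewrite (empty_eq0 B) card_ge0.
pose P (G : set (T * U)) := (forall p, G p -> A p.1 /\ B p.2) /\
  forall p q, G p -> G q -> (p.1 = q.1 <-> p.2 = q.2).
have [G [[GAB Ginj] Gmax]] : exists G, P G /\ forall H, G `<` H -> ~ P H.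
  apply: Zorn_bigcup => C CP Ctot; split=> [p [G CG Gp]|p q [G CG Gp] [H CH Hq]].
    exact: (CP _ CG).1.
  have [GH|HG] := Ctot _ _ CG CH.
    by apply: (CP _ CH).2 => //; exact: GH.
  by apply: (CP _ CG).2 => //; exact: HG.
have [/choice_on[f Gf]|/existsNP[a /not_implyP[Aa /forallNP Na]]] :=
    pselect (forall a, A a -> exists b, G (a, b)).
  left; apply/pcard_leP/injfunPex; exists f => [a /Gf/GAB[]//|a b].
  by move=> /set_mem/Gf Ga /set_mem/Gf Gb fab; exact/(Ginj _ _ Ga Gb).
have [/choice_on[f Gf]|/existsNP[b /not_implyP[Bb /forallNP Nb]]] :=
    pselect (forall b, B b -> exists a, G (a, b)).
  right; apply/pcard_leP/injfunPex; exists f => [b /Gf/GAB[]//|b c].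
  by move=> /set_mem/Gf Gb /set_mem/Gf Gc fbc; exact/(Ginj _ _ Gb Gc).
exfalso; apply: (Gmax (G `|` [set (a, b)])).
  by split; [exact: subsetUl|move=> /(_ (a, b) (or_intror erefl)); exact: Na].
split=> [p [/GAB//|->//]|[x y] [x' y'] /= [Gp|[-> ->]] [Gq|[-> ->]] //].
- exact: (Ginj _ _ Gp Gq).
- by split=> E; move: Gp; rewrite E; [move/Na|move/Nb].
- by split=> E; move: Gq; rewrite -E; [move/Na|move/Nb].
Qed.

(** Letting [f] act on all sequences gives the injections for different [A] a common type; values on
    sequences not over [A] are arbitrary. *)
Definition seq_injection {T : Type} (A : set T) (f : seq T -> T) :=
  (forall s, List.Forall A s -> A (f s)) /\
  forall s t, List.Forall A s -> List.Forall A t -> f s = f t -> s = t.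

Lemma Forall_map {T U : Type} {A : set T} {B : set U} {f : T -> U} :
  (forall x, A x -> B (f x)) ->
  forall s, List.Forall A s -> List.Forall B (map f s).
Proof. by move=> AB s; elim=> [|x {}s Ax _ IH] /=; constructor; auto. Qed.

Lemma Forall_map_inj {T U : Type} {A : set T} {f : T -> U} :
  (forall x y, A x -> A y -> f x = f y -> x = y) ->
  forall s t, List.Forall A s -> List.Forall A t -> map f s = map f t -> s = t.
Proof.
move=> finj s t As; elim: As t => [|x {}s Ax _ IH] [|y t] //= At [fxy fst].
by inversion At; subst; rewrite (finj x y) // (IH t).
Qed.

Lemma Forall_sub {T : Type} {A B : set T} :
  A `<=` B -> forall s, List.Forall A s -> List.Forall B s.
Proof. by move=> AB s; apply: List.Forall_impl. Qed.

(** Each entry lies in some member of the chain, and the largest of these finitely many members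
    contains them all; [i0] serves the empty sequence. *)
Lemma Forall_chain (I T : Type) (C : set I) (R : I -> I -> Prop) (A : I -> set T)
    (i0 : I) :
  (forall i j, R i j -> A i `<=` A j) -> total_on C R -> C i0 ->
  forall s, List.Forall (\bigcup_(i in C) A i) s ->
  exists2 i, C i & List.Forall (A i) s.
Proof.
move=> RA Ctot Ci0 s; elim=> [|x {}s [i Ci Aix] _ [j Cj Ajs]].
  by exists i0.
have [/RA Rij|/RA Rji] := Ctot _ _ Ci Cj.
  by exists j => //; constructor=> //; exact: Rij.
by exists i => //; constructor=> //; exact: Forall_sub Ajs.
Qed.

(* Points of [A] are coded by singletons and those of [B] by pairs. *)
Lemma seq_injection_setU {T : Type} {A B : set T} {f : seq T -> T} {k : T -> T} :
  seq_injection A f -> (forall x, B x -> A (k x)) ->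
  (forall x y, B x -> B y -> k x = k y -> x = y) ->
  exists2 h : T -> T, (forall x, (A `|` B) x -> A (h x)) &
    forall x y, (A `|` B) x -> (A `|` B) y -> h x = h y -> x = y.
Proof.
move=> [fA finj] kA kinj.
pose c x := if pselect (A x) then [:: x] else [:: k x; k x].
have cA x : (A `|` B) x -> List.Forall A (c x).
  by rewrite /c; case: pselect => [Ax _|nAx [//|Bx]]; do ?constructor; auto.
exists (f \o c) => [x ABx|x y ABx ABy /finj/=]; first exact/fA/cA.
move=> /(_ (cA _ ABx) (cA _ ABy)); rewrite /c.
case: pselect => Ax; case: pselect => Ay //; first by case.
by case: ABx => // Bx; case: ABy => // By [/kinj E _]; exact: E.
Qed.

(* Take a maximal injection of the finite sequences over some [A] into [A]. If
   the complement of [A] were larger than [A], it would contain a copy [B] of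
   [A], and the new sequences over [A `|` B] could be sent into [B]; hence [T]
   injects into [A]. *)
Lemma infinite_seq_injection (T : Type) :
  infinite_set [set: T] -> exists f : seq T -> T, injective f.
Proof.
elim/Ppointed: T => T; first by rewrite (empty_eq0 setT) => /(_ (finite_set0 _)).
move=> /infiniteP/pcard_leP/injfunPex[e _ einj0].
have einj m n : e m = e n -> m = n by move=> ?; apply: einj0; rewrite ?inE.
pose S := {p : set T * (seq T -> T) | seq_injection p.1 p.2}.
(* On a copy of the naturals, [pickle] codes finite sequences. The resulting [s0] also bounds the
   empty chain. *)
have [s0 _] : exists s0 : S, True.
  have /choice_on[d eK] : forall x, range e x -> exists n, e n = x.
    by move=> x [n _ <-]; exists n.
  suff H : seq_injection (range e) (fun s => e (pickle (map d s))).
    by exists (exist _ (range e, _) H).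
  split=> [s _|s t As At /einj/(pcan_inj pickleK)]; first by eexists.
  by apply: Forall_map_inj As At => x y /eK Ex /eK Ey dxy; rewrite -Ex dxy.
(* Extension is only a preorder: two functions may agree on the sequences over [A] and differ
   elsewhere. *)
pose R (s t : S) := (sval s).1 `<=` (sval t).1 /\
  forall l, List.Forall (sval s).1 l -> (sval s).2 l = (sval t).2 l.
have [||C Ctot|[[A f] fP] /= Amax] := @ZL_preorder S s0 (fun s t => `[<R s t>]).
- by move=> s; apply/asboolP; split.
- move=> r s t /asboolP[rs Ers] /asboolP[st Est]; apply/asboolP; split.
    exact: subset_trans st.
  by move=> l rl; rewrite Ers // Est //; exact: Forall_sub rl.
- have [[c0 Cc0]|/forallNP C0] := pselect (exists c, C c); last first.
    by exists s0 => s /C0.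
  have {}Ctot : total_on C R.
    by move=> s t Cs Ct; have [/asboolP|/asboolP] := Ctot _ _ Cs Ct; [left|right].
  pose U := \bigcup_(s in C) (sval s).1.
  have UC l : List.Forall U l -> exists2 s, C s & List.Forall (sval s).1 l.
    by apply: (Forall_chain _ _ _ _ _ c0 _ Ctot) => // i j [].
  have CU s : C s -> (sval s).1 `<=` U by move=> Cs x sx; exists s.
  (* [g] glues the functions of the chain, which agree wherever two of them are constrained because
     members are comparable. *)
  have /choice[g gP] : forall l, exists y, forall s, C s ->
      List.Forall (sval s).1 l -> (sval s).2 l = y.
    move=> l; have [/UC[s Cs sl]|nUl] := pselect (List.Forall U l).
      exists ((sval s).2 l) => t Ct tl.
      by have [[_ ->]|[_ ->]] := Ctot _ _ Cs Ct.
    by exists point => s /CU sU /(Forall_sub sU).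
  have H : seq_injection U g.
    split=> [l /UC[s Cs sl]|l m Ul Um].
      by rewrite -(gP _ _ Cs sl); apply: (CU _ Cs); exact: (svalP s).1.
    (* Concatenation places both sequences over one member of the chain. *)
    have [s Cs] : exists2 s, C s & List.Forall (sval s).1 (l ++ m).
      by apply/UC/List.Forall_app.
    move=> /List.Forall_app[sl sm]; rewrite -(gP _ _ Cs sl) -(gP _ _ Cs sm).
    exact: (svalP s).2.
  exists (exist _ (U, g) H) => s Cs; apply/asboolP; split=> /=; first exact: CU.
  by move=> l sl; rewrite (gP _ _ Cs sl).
have [/pcard_leP/injfunPex[k kA kinj]|] := card_le_total (~` A) A.
  have [||h hA hinj] := @seq_injection_setU _ _ (~` A) _ k fP.
  - by move=> x; exact: kA.
  - by move=> x y Ax Ay; apply: kinj; rewrite inE.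
  rewrite setUCr in hA hinj.
  have T_ s : List.Forall [set: T] s by apply/List.Forall_forall.
  have hs s := Forall_map hA _ (T_ s).
  by exists (f \o map h) => s t /fP.2-/(_ (hs s) (hs t))/(Forall_map_inj hinj); exact.
move=> /pcard_leP/injfunPex[g gA ginj0].
have ginj x y : A x -> A y -> g x = g y -> x = y.
  by move=> Ax Ay; apply: ginj0; rewrite inE.
pose B := g @` A.
have /choice_on[k kP] : forall y, B y -> exists x, A x /\ g x = y.
  by move=> _ [x Ax <-]; exists x.
have [||h hA hinj] := @seq_injection_setU _ A B _ k fP.
- by move=> x /kP[].
- by move=> x y /kP[_ {2}<-] /kP[_ {2}<-] ->.
(* Old sequences keep their values in [A], the others go to [B]; the two kinds cannot clash because
   [gA] puts [B] outside [A]. *)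
pose f' l := if pselect (List.Forall A l) then f l else g (f (map h l)).
have fhA l : List.Forall (A `|` B) l -> A (f (map h l)).
  by move=> ABl; apply: fP.1; exact: Forall_map ABl.
have H : seq_injection (A `|` B) f'.
  split=> [l ABl|l m ABl ABm]; rewrite /f'.
    by case: pselect => Al; [left; exact: fP.1|right; exists (f (map h l)); auto].
  case: pselect => Al; case: pselect => Am.
  - exact: fP.2.
  - by move=> /= E; case: (gA _ (fhA _ ABm)); rewrite -E; exact: fP.1.
  - by move=> /= E; case: (gA _ (fhA _ ABl)); rewrite E; exact: fP.1.
  - move=> /ginj => /(_ (fhA _ ABl) (fhA _ ABm)) /fP.2.
    move=> /(_ (Forall_map hA _ ABl) (Forall_map hA _ ABm)).
    exact: (Forall_map_inj hinj).
have /Amax/asboolP[/= ABA _] : `[<R (exist _ (A, f) fP) (exist _ (A `|` B, f') H)>].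
  apply/asboolP; split=> [|l Al] /=; first exact: subsetUl.
  by rewrite /f'; case: pselect.
(* Maximality has forced [B] into [A], yet [g (f [::])] lies in [B] and outside [A]. *)
have A0 : A (f [::]) by exact: fP.1.
by case: (gA _ A0); apply: ABA; right; exists (f [::]).
Qed.

Lemma separating_family (T : Type) : infinite_set [set: T] ->
  exists phi : T -> (T -> bool) -> nat,
    forall (I : finType) (c : I -> T -> bool),
      exists w (r : nat -> T -> bool), forall i, r (phi w (c i)) = c i.
Proof.
move=> /infinite_seq_injection[f finj].
have /choice[g gK] : forall w, exists s, forall t, f t = w -> t = s.
  move=> w; have [[s <-]|fw] := pselect (exists s, f s = w).
    by exists s => t /finj.
  by exists [::] => t ftw; case: fw; exists t.
(* [g w] lists the coordinates coded by [w]; the values of [u] there form a boolean sequence, coded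
   as a number. *)
exists (fun w u => pickle (map u (g w))) => I c.
(* [d] picks a coordinate at which two members of the family differ, if there is one. *)
have /choice[d dP] : forall p : I * I, exists x, c p.1 x = c p.2 x -> c p.1 = c p.2.
  move=> p; have [|/existsNP[x nx]] := pselect (forall x, c p.1 x = c p.2 x).
    by move=> /funext E; exists (f [::]).
  by exists x.
pose s := map d (enum {: I * I}).
have sP i j : map (c i) s = map (c j) s -> c i = c j.
  rewrite -!map_comp => /eq_in_map cij; apply: (dP (i, j)).
  by apply: cij; rewrite -enumT mem_enum.
exists (f s); rewrite -(gK (f s) s erefl).
have /choice[r rP] : forall n, exists u, forall i, pickle (map (c i) s) = n -> c i = u.
  move=> n; have [[i <-]|cn] := pselect (exists i, pickle (map (c i) s) = n).
    by exists (c i) => j /(pcan_inj pickleK)/sP.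
  by exists (fun=> true) => i cin; case: cn; exists i.
by exists r => i; rewrite -(rP _ i).
Qed.

(** Arguments in the range have preimages, so the range is closed under the operations; the inverse
    [k] is a homomorphism because [h] is an injective one. *)
Lemma isomorphic_range {S : signature} {A C : algebra S} (h : hom A C) :
  injective h -> exists B : subalgebra C, isomorphic B A.
Proof.
move=> hinj.
have hop (o : symbol S) (x : 'I_(arity o) -> C) :
    (forall i, range h (x i)) -> range h (op x).
  move=> xh; have /choice[y yx] : forall i, exists z, h z = x i.
    by move=> i; have [z _] := xh i; exists z.
  by exists (op y) => //; rewrite homP; congr op; apply: funext.
exists (Subalgebra hop).
have /choice[k kP] : forall b : Subalgebra hop, exists x, h x = sval b.
  by move=> [b [x xT hx]]; exists x.
have khom (o : symbol S) (x : 'I_(arity o) -> Subalgebra hop) :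
    k (op x) = op (k \o x).
  by apply: hinj; rewrite kP homP; congr op; apply: funext => i /=; rewrite kP.
exists (Hom khom), (fun x => exist _ (h x) (imageT h x)) => [b|x].
  by apply: eq_sig_hprop => [c|]; [exact: Prop_irrelevance|exact: kP].
by apply: hinj; rewrite /= kP.
Qed.

Theorem theorem3p1 (Omega : Type) (V : variety) (F : set_functor V) :
  infinite_set [set: Omega] ->
  (forall I : Type,
     [set: F I] =
     \bigcup_(n in [set: nat]) \bigcup_(a in [set: 'I_n -> I]) range (fmap F a)) ->
  exists B : subalgebra (power (F nat) Omega), isomorphic B (F (Omega -> bool)).
Proof.
move=> /separating_family[phi phiP] Ffin.
pose Phi (x : F (Omega -> bool)) : power (F nat) Omega :=
  fun w => fmap F (phi w) x.
have Phi_op (o : symbol (sig_of V)) (x : 'I_(arity o) -> F (Omega -> bool)) :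
    Phi (op x) = op (Phi \o x).
  by apply: funext => w; rewrite /Phi homP.
apply: (isomorphic_range (Hom Phi_op)) => x y /= xy.
have FE z : exists n (a : 'I_n -> Omega -> bool) z', fmap F a z' = z.
  have : [set: F (Omega -> bool)] z by [].
  by rewrite Ffin => -[n _ [a _ [z' _ <-]]]; exists n, a, z'.
have [n [a [x' xE]]] := FE x; have [m [b [y' yE]]] := FE y.
(* A single [w] must serve both elements, so the two finite families are joined over a disjoint
   sum. *)
have [w [r rP]] := phiP _ (fun i : 'I_n + 'I_m =>
  match i with inl i => a i | inr j => b j end).
(* [r] undoes [phi w] on the values of [a], so [fmap F r] undoes [fmap F (phi w)] on the image of
   [fmap F a]. *)
have rx : fmap F r (fmap F (phi w) x) = x.
  rewrite -xE -!fmap_comp; congr (fmap F _ x').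
  by apply: funext => i; exact: (rP (inl i)).
have ry : fmap F r (fmap F (phi w) y) = y.
  rewrite -yE -!fmap_comp; congr (fmap F _ y').
  by apply: funext => i; exact: (rP (inr i)).
by rewrite -rx -ry; congr (fmap F r _); exact: (congr1 (fun h => h w) xy).
Qed.
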